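(* Let $N_{\mathrm{ca}} \geq 1$ be an integer, let $K_1, \ldots, K_{N_{\mathrm{ca}}} \geq 2$ be integers, and let $\xi = 0.27$. For each $n \in \{1, \ldots, N_{\mathrm{ca}}\}$ let the margin be $$q^{\min}_n = \frac{1}{K_n - 1}\left(1 - (1-\xi)^{\frac{1}{N_{\mathrm{ca}}}}\right),$$ and suppose that the parameter $q = (q_{n,k})$ of the categorical distribution satisfies, for all $n \in \{1,\ldots,N_{\mathrm{ca}}\}$, $$q_{n,1} = 1 - q^{\min}_n (K_n - 1), \qquad q_{n,k} = q^{\min}_n \ \text{ for all } k \in \{2, \ldots, K_n\}.$$ Assume (without loss of generality) that the category of the optimal solution is the first category in every dimension $n$. Let $\lambda \geq 6$ be an integer, let $c_1, \ldots, c_\lambda$ be independent samples from the categorical distribution with parameter $q$, and let $\lambda_{\mathrm{non}}$ be the random variable that counts the number of samples among these $\lambda$ samples that contain a non-optimal category. Then $$\Pr\left(\lambda_{\mathrm{non}} \leq \lambda - \left\lfloor \frac{\lambda}{2} \right\rfloor\right) \geq 0.95 .$$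
   Context: Categorical domain: $\mathcal{C} = \mathcal{C}_1 \times \cdots \times \mathcal{C}_{N_{\mathrm{ca}}}$, where $\mathcal{C}_n = \{ c_n \in \{0,1\}^{K_n} : \sum_{k=1}^{K_n} c_{n,k} = 1\}$ is the set of one-hot vectors of length $K_n$; $c_{n,k}$ denotes the $k$-th entry of $c_n$, and $K_n$ is the number of categories of the $n$-th categorical variable. Categorical distribution: for a parameter $q = (q_{n,k})$ with $q_{n,k} \in [0,1]$ and $\sum_{k=1}^{K_n} q_{n,k} = 1$ for each $n$, the categorical distribution on $\mathcal{C}$ has probability mass function $p(c \mid q) = \prod_{n=1}^{N_{\mathrm{ca}}} \prod_{k=1}^{K_n} (q_{n,k})^{c_{n,k}}$. Thus the components $c_1, \ldots, c_{N_{\mathrm{ca}}}$ of a sample are independent, and $q_{n,k}$ is the probability that $c_{n,k} = 1$. A sample $c \in \mathcal{C}$ contains a non-optimal category if, for at least one $n \in \{1,\ldots,N_{\mathrm{ca}}\}$, its category in dimension $n$ is not that of the optimal solution; when the optimal category is the first one in every dimension, this means $c_{n,1} \neq 1$ for at least one $n$. *)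

(* Defs.v *)
From HB Require Import structures.
From mathcomp Require Import all_boot all_order all_algebra.
From mathcomp Require Import all_classical all_reals all_analysis.
Set Implicit Arguments.
Unset Strict Implicit.
Unset Printing Implicit Defensive.
Import Order.TTheory GRing.Theory Num.Theory.
Local Open Scope classical_set_scope.
Local Open Scope ring_scope.

(* {0,1} is encoded by bool, which coerces to nat. *)
Definition one_hot (k : nat) : Type :=
  {c : {ffun 'I_k -> bool} | (\sum_(i < k) c i == 1)%N}.

HB.instance Definition _ (k : nat) := Finite.on (one_hot k).

Lemma hot_at_subproof (k : nat) (i : 'I_k) :
  (\sum_(j < k) [ffun j : 'I_k => j == i] j == 1)%N.
Proof.
rewrite (bigD1 i) //= ffunE eqxx big1 ?addn0 // => j /negbTE ji.
by rewrite ffunE ji.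
Qed.

Definition hot_at (k : nat) (i : 'I_k) : one_hot k :=
  exist _ [ffun j => j == i] (hot_at_subproof i).

(* The ordinals of 'I_(K n) are the categories of the n-th variable; the first
   category, numbered 1 in mathematical notation, has ordinal value 0. *)
Definition first_category (N : nat) (K : 'I_N -> nat)
    (K_ge2 : forall n, (2 <= K n)%N) (n : 'I_N) : 'I_(K n) :=
  Ordinal (ltnW (K_ge2 n)).

(* The library's measurable types are pointed, so the bounds on the numbers of
   categories, which make the domain nonempty, are a parameter of the type. *)
Definition categorical_domain (N : nat) (K : 'I_N -> nat)
    (K_ge2 : forall n, (2 <= K n)%N) : Type :=
  {dffun forall n : 'I_N, one_hot (K n)}.

Section categorical_domain_structures.
Context (N : nat) (K : 'I_N -> nat) (K_ge2 : forall n, (2 <= K n)%N).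
Let C := categorical_domain K_ge2.

HB.instance Definition _ :=
  Finite.copy C {dffun forall n : 'I_N, one_hot (K n)}.

HB.instance Definition _ := isPointed.Build C
  (finfun (fun n : 'I_N => hot_at (first_category K_ge2 n))).

HB.instance Definition _ := @isMeasurable.Build default_measure_display C
  (discrete_measurable (T := C)) (@discrete_measurable0 C)
  (@discrete_measurableC C) (@discrete_measurableU C).

End categorical_domain_structures.

Definition component (N : nat) (K : 'I_N -> nat)
    (K_ge2 : forall n, (2 <= K n)%N) (c : categorical_domain K_ge2)
    (n : 'I_N) : one_hot (K n) :=
  (c : {dffun forall n : 'I_N, one_hot (K n)}) n.

Definition entry (N : nat) (K : 'I_N -> nat)
    (K_ge2 : forall n, (2 <= K n)%N) (c : categorical_domain K_ge2)
    (n : 'I_N) (k : 'I_(K n)) : bool :=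
  val (component c n) k.

Definition categorical_parameter (R : realType) (N : nat) (K : 'I_N -> nat)
    (q : forall n : 'I_N, 'I_(K n) -> R) : Prop :=
  (forall n k, 0 <= q n k <= 1) /\ (forall n, \sum_(k < K n) q n k = 1).

Definition categorical_pmf (R : realType) (N : nat) (K : 'I_N -> nat)
    (K_ge2 : forall n, (2 <= K n)%N) (q : forall n : 'I_N, 'I_(K n) -> R)
    (c : categorical_domain K_ge2) : R :=
  \prod_(n < N) \prod_(k < K n) q n k ^+ entry c k.

Definition has_categorical_distribution (R : realType) (N : nat)
    (K : 'I_N -> nat) (K_ge2 : forall n, (2 <= K n)%N)
    (d : measure_display) (T : measurableType d) (P : probability T R)
    (q : forall n : 'I_N, 'I_(K n) -> R)
    (X : {RV P >-> categorical_domain K_ge2}) : Prop :=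
  forall c : categorical_domain K_ge2,
    distribution P X [set c] = (categorical_pmf q c)%:E.

Definition mutually_independent (R : realType) (d d' : measure_display)
    (T : measurableType d) (T' : measurableType d') (P : probability T R)
    (I : finType) (X : I -> {RV P >-> T'}) : Prop :=
  forall (J : {set I}) (A : I -> set T'),
    (forall i, i \in J -> measurable (A i)) ->
    P (\bigcap_(i in [set` J]) (X i @^-1` A i)) =
    (\prod_(i in J) P (X i @^-1` A i))%E.

Definition margin (R : realType) (N : nat) (K : 'I_N -> nat) (xi : R)
    (n : 'I_N) : R :=
  1 / ((K n)%:R - 1) * (1 - (1 - xi) `^ (1 / N%:R)).

Definition contains_non_optimal (N : nat) (K : 'I_N -> nat)
    (K_ge2 : forall n, (2 <= K n)%N) (copt c : categorical_domain K_ge2)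
    : bool :=
  [exists n : 'I_N, component c n != component copt n].

Definition lambda_non (N : nat) (K : 'I_N -> nat)
    (K_ge2 : forall n, (2 <= K n)%N) (copt : categorical_domain K_ge2)
    (lambda : nat) (T : Type) (c : 'I_lambda -> T -> categorical_domain K_ge2)
    (t : T) : nat :=
  #|[pred i : 'I_lambda | contains_non_optimal copt (c i t)]|.

(* Main.v *)
(* A sample is optimal with probability (1 - xi)^(1/N) to the power N, that is
   1 - xi, so lambda_non has the binomial distribution with parameters lambda
   and p = 0.27.  Writing b for the mass function of Bin(2m, p), two more trials
   give Pr(Bin(2m+2, p) <= m+1) - Pr(Bin(2m, p) <= m)
   = (1-p)^2 b(m+1) - p^2 b(m), which is nonnegative as soon as
   p (m+1) <= (1-p) m.  Hence lambda = 6, where the probability is about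
   0.9508, is the worst even case, and an odd lambda has the same threshold as
   lambda + 1. *)
Require Import Defs.
From mathcomp Require Import all_boot all_order all_algebra.
From mathcomp Require Import all_classical all_reals all_analysis.
From mathcomp Require Import unstable ring lra zify.
Set Implicit Arguments.
Unset Strict Implicit.
Unset Printing Implicit Defensive.
Import Order.TTheory GRing.Theory Num.Theory.
Local Open Scope classical_set_scope.
Local Open Scope ring_scope.

Definition binomial_cdf (R : realType) (n : nat) (p : R) (k : nat) : R :=
  \sum_(j < k.+1) binomial_pmf n p j.

(** The event splits into the disjoint events [E J], where [J] is the exact set of indices whose
    sample satisfies [B]. Each has probability [p ^+ #|J| * p.~ ^+ (#|I| - #|J|)], and ['C(#|I|, j)]
    sets have size [j]. *)
Lemma independent_count_cdf (R : realType) (d d' : measure_display)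
    (T : measurableType d) (T' : measurableType d') (P : probability T R)
    (I : finType) (X : I -> {RV P >-> T'}) (X_indep : mutually_independent X)
    (B : pred T') (mB : measurable [set x | B x]) (p : R)
    (X_p : forall i, P (X i @^-1` [set x | B x]) = p%:E) (k : nat) :
  P [set t | (#|[pred i | B (X i t)]| <= k)%N] = (binomial_cdf #|I| p k)%:E.
Proof.
pose A (J : {set I}) i := if i \in J then [set x | B x] else ~` [set x | B x].
pose E (J : {set I}) := \bigcap_(i in [set` [set: I]%SET]) (X i @^-1` A J i).
have mA J i : measurable (A J i).
  by rewrite /A; case: ifP => // _; exact: measurableC.
have mXA J i : measurable (X i @^-1` A J i).
  exact: measurable_funPTI.
have mE J : measurable (E J).
  by apply: fin_bigcap_measurable => // i _; exact: mXA.
have EP J t : E J t <-> [set i | B (X i t)]%SET = J.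
  split=> [EJt|<- i _]; last first.
    by rewrite /A /= inE; case: ifPn => //= /negP.
  apply/setP => i; rewrite inE; have := EJt i; rewrite /A /= inE => /(_ isT).
  by case: ifP => _ /=; [|move/negP/negbTE].
have PE J : P (E J) = (p ^+ #|J| * p.~ ^+ (#|I| - #|J|))%:E.
  (* Independence is applied to the full index set, with [B] required on [J] and its complement
     elsewhere. *)
  rewrite /E X_indep; last by [].
  under eq_bigr => i _.
    have -> : P (X i @^-1` A J i) = (if i \in J then p else p.~)%:E.
      rewrite /A; case: ifP => _; first exact: X_p.
      by rewrite -preimage_setC probability_setC ?X_p //;
        exact: (measurable_funPTI (X i) mB).
    over.
  rewrite prodEFin (eq_bigl xpredT) => [|i]; last by rewrite inE.
  rewrite (bigID (mem J)) /=; congr (_ * _)%:E.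
    by under eq_bigr => i -> do []; rewrite prodr_const.
  under eq_bigr => i /negbTE -> do [].
  by rewrite prodr_const -(cardC J) addKn.
pose D := [pred J : {set I} | (#|J| <= k)%N].
have -> : [set t | (#|[pred i | B (X i t)]| <= k)%N] = \bigcup_(J in [set` D]) E J.
  apply/seteqP; split=> t /=; rewrite -cardsE.
    by move=> tk; exists [set i | B (X i t)]%SET => //; apply/EP.
  by move=> [J /= Jk /EP ->].
rewrite measure_fin_bigcup //; last first.
  by move=> J J' _ _ [t [/EP <- /EP <-]].
rewrite (_ : [set` D] = [set` enum D]); last first.
  by apply/seteqP; split=> J /=; rewrite mem_enum.
rewrite -fsbig_seq ?enum_uniq // big_enum /=.
under eq_bigr => J _ do rewrite PE.
rewrite sumEFin; congr (_%:E).
(* Group the sets by size; [inord] never falls back to its default value, since [#|J| <= k] on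
   [D]. *)
rewrite (partition_big (fun J : {set I} => inord #|J| : 'I_k.+1) xpredT) //=.
apply: eq_bigr => j _; rewrite /binomial_pmf -card_draws -sumr_const.
have jk := ltn_ord j.
apply: eq_big => J; last first.
  by move=> /andP[Jk /eqP/(congr1 val)]; rewrite /= inordK // => ->.
rewrite !inE; apply/andP/eqP => [[Jk /eqP/(congr1 val)]|Jj].
  by rewrite /= inordK.
by rewrite Jj; split; [|apply/eqP/val_inj; rewrite /= inordK].
Qed.

(** Pascal's rule, that is, conditioning on the outcome of one extra trial. *)
Lemma binomial_pmfS (R : realType) (n : nat) (p : R) (k : nat) :
  binomial_pmf n.+1 p k.+1 = p.~ * binomial_pmf n p k.+1 + p * binomial_pmf n p k.
Proof.
rewrite /binomial_pmf binS mulrnDr subSS; congr (_ + _); last first.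
  by rewrite exprS -mulrA mulrnAr.
have [kn|nk] := ltnP k n; last by rewrite bin_small // !mulr0n mulr0.
by rewrite -(subnSK kn) [p.~ ^+ _.+1]exprS mulrnAr mulrCA.
Qed.

Lemma binomial_cdfSk (R : realType) (n : nat) (p : R) (k : nat) :
  binomial_cdf n p k.+1 = binomial_cdf n p k + binomial_pmf n p k.+1.
Proof. by rewrite /binomial_cdf big_ord_recr. Qed.

(** An extra trial lifts the count above [k] exactly when it succeeds and the count was already
    [k]. *)
Lemma binomial_cdfSn (R : realType) (n : nat) (p : R) (k : nat) :
  binomial_cdf n.+1 p k = binomial_cdf n p k - p * binomial_pmf n p k.
Proof.
elim: k => [|k IH]; last by rewrite !binomial_cdfSk IH binomial_pmfS /onem; ring.
rewrite /binomial_cdf !big_ord1 /binomial_pmf !bin0 !expr0 !mul1r !subn0 !mulr1n.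
by rewrite exprS /onem; ring.
Qed.

(** The ratio of consecutive masses, cross-multiplied to avoid division; it comes from
    [k.+1 * 'C(n, k.+1) = (n - k) * 'C(n, k)]. *)
Lemma binomial_pmf_ratio (R : realType) (n : nat) (p : R) (k : nat) :
  k.+1%:R * p.~ * binomial_pmf n p k.+1 = (n - k)%:R * p * binomial_pmf n p k.
Proof.
have [kn|nk] := ltnP k n; last first.
  have /eqP -> : (n - k == 0)%N by rewrite subn_eq0.
  by rewrite /binomial_pmf bin_small // mulr0n !mul0r mulr0.
have := congr1 (fun m => m%:R : R) (mul_bin_left n k); rewrite !natrM => e.
rewrite /binomial_pmf -[_ *+ 'C(n, k)]mulr_natr -[_ *+ 'C(n, k.+1)]mulr_natr.
rewrite -(subnSK kn) [p ^+ _.+1]exprS [p.~ ^+ _.+1]exprS.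
set a := p ^+ k; set b := p.~ ^+ _.
transitivity (p.~ * p * a * b * (k.+1%:R * 'C(n, k.+1)%:R)); first by ring.
by rewrite e -(subnSK kn); ring.
Qed.

Lemma le_binomial_cdf_double (R : realType) (p : R) (m : nat) :
  0 <= p <= 1 -> p * m.+1%:R <= p.~ * m%:R ->
  binomial_cdf m.*2 p m <= binomial_cdf m.+1.*2 p m.+1.
Proof.
move=> p01 pm; have /andP[p0 _] := p01.
have b0 : 0 <= binomial_pmf m.*2 p m by exact: binomial_pmf_ge0.
have r := binomial_pmf_ratio m.*2 p m.
rewrite doubleS !binomial_cdfSn binomial_cdfSk binomial_pmfS.
move: b0 r; rewrite -addnn addnK.
set b := binomial_pmf _ p m; set b' := binomial_pmf _ p m.+1 => b0 r.
suff : p ^+ 2 * b <= p.~ ^+ 2 * b' by rewrite /onem; lra.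
have m0 : 0 < m.+1%:R :> R by [].
(* The factor [m.+1] lets the ratio identity replace [b'] by [b]; what remains is the hypothesis on
   [p] times [p * b]. *)
rewrite -(ler_pM2l m0).
have -> : m.+1%:R * (p.~ ^+ 2 * b') = p.~ * (m.+1%:R * p.~ * b') by ring.
rewrite r.
have -> : m.+1%:R * (p ^+ 2 * b) = (p * m.+1%:R) * (p * b) by ring.
have -> : p.~ * (m%:R * p * b) = (p.~ * m%:R) * (p * b) by ring.
by rewrite ler_wpM2r // mulr_ge0.
Qed.

Lemma binomial_cdf_6_3 (R : realType) :
  95 / 100 <= binomial_cdf 6 (27 / 100 : R) 3.
Proof.
rewrite /binomial_cdf !big_ord_recr big_ord0 /= /binomial_pmf.
rewrite (_ : 'C(6, 0) = 1)%N // (_ : 'C(6, 1) = 6)%N //.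
rewrite (_ : 'C(6, 2) = 15)%N // (_ : 'C(6, 3) = 20)%N //.
by rewrite !subSS !subn0 /onem; lra.
Qed.

Lemma binomial_cdf_half (R : realType) (n : nat) : (6 <= n)%N ->
  95 / 100 <= binomial_cdf n (27 / 100 : R) (n - n %/ 2).
Proof.
set p : R := 27 / 100; have p01 : 0 <= p <= 1 by rewrite /p; lra.
have even m : (3 <= m)%N -> 95 / 100 <= binomial_cdf m.*2 p m.
  elim: m => // m IH; rewrite leq_eqVlt => /predU1P[[<-]|m3].
    exact: binomial_cdf_6_3.
  apply: (le_trans (IH m3)); apply: le_binomial_cdf_double => //.
  (* For this [p] the condition reads 0.27 <= 0.46 m. *)
  have : 3%:R <= m%:R :> R by rewrite ler_nat.
  by rewrite -natr1 /onem /p; lra.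
move=> n6; rewrite divn2; set m := n./2.
have [nE|nE] : n = m.*2 \/ n = m.*2.+1.
- by rewrite -(odd_double_half n); case: (odd n); [right|left].
- by rewrite nE -addnn addnK addnn; apply: even; lia.
(* [binomial_cdf n k] decreases in [n], so the odd case [m.*2.+1] follows from
   the even case [m.+1.*2], which has the same threshold [m.+1]. *)
have -> : (n - m = m.+1)%N by lia.
apply: (le_trans (even m.+1 _)); first by lia.
rewrite nE doubleS binomial_cdfSn gerBl mulr_ge0 ?binomial_pmf_ge0 //.
by case/andP: p01.
Qed.

(** A second entry equal to 1 would bring the sum of the entries to at least 2. *)
Lemma one_hot_entryE (k : nat) (c : one_hot k) (i j : 'I_k) :
  val c i = true -> val c j = (j == i).
Proof.
move=> ci; have [->//|ji] := eqVneq j i.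
have := valP c; rewrite /= (bigD1 i) //= (bigD1 j) //=.
by move: ci => /= ->; case: (sval c j).
Qed.

Lemma categorical_pmf_first (R : realType) (N : nat) (K : 'I_N -> nat)
    (K_ge2 : forall n, (2 <= K n)%N) (q : forall n : 'I_N, 'I_(K n) -> R)
    (c : categorical_domain K_ge2) :
  (forall n, entry c (first_category K_ge2 n) = true) ->
  categorical_pmf q c = \prod_(n < N) q n (first_category K_ge2 n).
Proof.
move=> c_first; apply: eq_bigr => n _.
rewrite (bigD1 (first_category K_ge2 n)) //= c_first expr1 big1 ?mulr1 // => k.
move=> /negbTE k1.
by rewrite /entry (one_hot_entryE _ (c_first n)) k1 expr0.
Qed.

(** This makes the non-optimal event the complement of a singleton, whose probability the mass
    function gives directly. *)
Lemma contains_non_optimalE (N : nat) (K : 'I_N -> nat)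
    (K_ge2 : forall n, (2 <= K n)%N) (copt c : categorical_domain K_ge2) :
  contains_non_optimal copt c = (c != copt).
Proof.
apply/existsP/negP => [[n cn] /eqP cE|c_neq]; first by rewrite cE eqxx in cn.
apply: contrapT => c_opt; apply: c_neq; apply/eqP/ffunP => n.
by apply/eqP/negP => /negP cn; apply: c_opt; exists n.
Qed.

Theorem proposition4p1 (R : realType) (N : nat) (N_ge1 : (1 <= N)%N)
    (K : 'I_N -> nat) (K_ge2 : forall n, (2 <= K n)%N)
    (xi : R) (xiE : xi = 27 / 100)
    (q : forall n : 'I_N, 'I_(K n) -> R) (q_param : categorical_parameter q)
    (q_first : forall n : 'I_N,
      q n (first_category K_ge2 n) = 1 - margin K xi n * ((K n)%:R - 1))
    (q_other : forall (n : 'I_N) (k : 'I_(K n)),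
      k != first_category K_ge2 n -> q n k = margin K xi n)
    (copt : categorical_domain K_ge2)
    (copt_first : forall n : 'I_N, entry copt (first_category K_ge2 n) = true)
    (lambda : nat) (lambda_ge6 : (6 <= lambda)%N)
    (d : measure_display) (T : measurableType d) (P : probability T R)
    (c : 'I_lambda -> {RV P >-> categorical_domain K_ge2})
    (c_indep : mutually_independent c)
    (c_dist : forall i : 'I_lambda, has_categorical_distribution q (c i)) :
  ((95 / 100 : R)%:E <=
    P [set t | (lambda_non copt (fun i => c i) t <= lambda - lambda %/ 2)%N])%E.
Proof.
have q1E n : q n (first_category K_ge2 n) = (1 - xi) `^ (1 / N%:R).
  have K1 : (K n)%:R - 1 != 0 :> R.
    by rewrite subr_eq0 pnatr_eq1; have := K_ge2 n; case: (K n) => [|[]].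
  by rewrite q_first /margin mulrAC divfK // !mul1r subKr.
have pmfE : categorical_pmf q copt = 1 - xi.
  rewrite categorical_pmf_first //; under eq_bigr => n _ do rewrite q1E.
  rewrite prodr_const card_ord -powR_mulrn ?powR_ge0 // -powRrM.
  (* The exponents [1 / N] and [N] cancel because [N] is positive. *)
  rewrite mul1r mulVf ?pnatr_eq0 -?lt0n // powRr1 // xiE; lra.
have c_non i : P (c i @^-1` [set x | contains_non_optimal copt x]) = xi%:E.
  have -> : [set x | contains_non_optimal copt x] = ~` [set copt].
    by apply/seteqP; split=> x /=; rewrite contains_non_optimalE => /eqP.
  rewrite -preimage_setC probability_setC; last exact: measurable_funPTI.
  have -> : P (c i @^-1` [set copt]) = (categorical_pmf q copt)%:E.
    exact: c_dist.
  by rewrite pmfE -EFinB subKr.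
rewrite (independent_count_cdf c_indep _ c_non) // card_ord lee_fin xiE.
exact: binomial_cdf_half.
Qed.
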